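(* Let $(\Omega,\mathcal F,\nu)$ be a probability space, let $\mathcal W:\Omega\to\mathbb R$ be measurable with $\mathcal Z:=\mathbb E_\nu[e^{-\mathcal W}]<\infty$, and let $\nu^*$ be the optimal proposal measure defined by $\frac{\mathrm d\nu^*}{\mathrm d\nu}=\frac{e^{-\mathcal W}}{\mathcal Z}$. Let $\widetilde\nu$ be a probability measure on $(\Omega,\mathcal F)$ with $\nu\ll\widetilde\nu$. Then the relative error $$r(\widetilde\nu)=\frac{1}{\mathcal Z}\sqrt{\operatorname{Var}_{\widetilde\nu}\left(e^{-\mathcal W}\frac{\mathrm d\nu}{\mathrm d\widetilde\nu}\right)}$$ satisfies $$r(\widetilde\nu)\ \ge\ \sqrt{e^{\operatorname{KL}(\nu^*|\widetilde\nu)}-1}.$$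
   Context: $\operatorname{KL}(\nu^*|\widetilde\nu)=\mathbb E_{\nu^*}\left[\log\frac{\mathrm d\nu^*}{\mathrm d\widetilde\nu}\right]$ is the Kullback-Leibler divergence. $\operatorname{Var}_{\widetilde\nu}$ is the variance under $\widetilde\nu$. The quantities $r(\widetilde\nu)$ and $\operatorname{KL}(\nu^*|\widetilde\nu)$ are allowed to take the value $+\infty$. *)

(* Defs.v *)
From HB Require Import structures.
From mathcomp Require Export all_boot all_order all_algebra.
From mathcomp Require Export all_classical all_reals all_analysis measurable_realfun.

Set Implicit Arguments.
Unset Strict Implicit.
Unset Printing Implicit Defensive.

Import Order.TTheory GRing.Theory Num.Theory.
Import numFieldNormedType.Exports.

Local Open Scope classical_set_scope.
Local Open Scope ring_scope.
Local Open Scope charge_scope.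
Local Open Scope ereal_scope.

Section importance_sampling.
Context {d : measure_display} {T : measurableType d} {R : realType}.
Implicit Types (nu nus nut P Q : probability T R) (W : T -> R).

(* A real-valued version of dP/dQ.  When P `<< Q, the library's derivative
   takes finite values everywhere, so fine loses nothing. *)
Definition RN_deriv P Q (x : T) : R :=
  fine (('d (charge_of_finite_measure P) '/d Q) x).

(* For P `<< Q, the derivative is positive P-a.e., so the convention that ln
   vanishes on nonpositive reals is immaterial, and the negative part of the
   integrand always has a finite integral. *)
Definition KL P Q : \bar R :=
  if `[< P `<< Q >] then 'E_P[fun x => ln (RN_deriv P Q x)] else +oo.

Definition partition_fun nu W : \bar R := 'E_nu[fun x => expR (- W x)].

Definition is_optimal_proposal nu W nus : Prop :=
  forall A, measurable A ->
    nus A = \int[nu]_(x in A) ((expR (- W x))%:E / partition_fun nu W).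

Definition relative_error nu W nut : \bar R :=
  (partition_fun nu W)^-1 *
  sqrte 'V_nut[fun x => (expR (- W x) * RN_deriv nu nut x)%R].

End importance_sampling.

(* Main.v *)
(* Let [g] be the density of [nustar] with respect to [nutilde].  By the chain
   rule [expR (- W) * dnu/dnutilde = Z * g] almost everywhere, so the squared
   relative error is [\int[nutilde] (g - 1) ^+ 2], which is
   [\int[nutilde] g ^+ 2 - 1 = 'E_nustar[g] - 1].  Jensen's inequality for [ln]
   under [nustar] gives [expeR (KL nustar nutilde) <= 'E_nustar[g]]. *)
Require Import Defs.
From mathcomp Require Import ring lra.

Set Implicit Arguments.
Unset Strict Implicit.
Unset Printing Implicit Defensive.

Import Order.TTheory GRing.Theory Num.Theory.

Local Open Scope classical_set_scope.
Local Open Scope ring_scope.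
Local Open Scope charge_scope.
Local Open Scope ereal_scope.

(** * Comparison and positivity of integrals, then Jensen's inequality for the logarithm *)

Section integral_lemmas.
Context d (T : measurableType d) (R : realType).

(** Positive and negative parts are compared separately, so [f] and [g] may have infinite integrals;
    subtraction in [\bar R] is monotone even at infinity. *)
Lemma ae_le_integral (mu : {measure set T -> \bar R}) (D : set T)
    (f g : T -> \bar R) :
  measurable D -> measurable_fun D f -> measurable_fun D g ->
  {ae mu, forall x, D x -> f x <= g x} ->
  \int[mu]_(x in D) f x <= \int[mu]_(x in D) g x.
Proof.
move=> mD mf mg fg; rewrite integralE [leRHS]integralE leeB//.
- apply: ae_ge0_le_integral => //; [exact: measurable_funepos..|].
  apply: filterS fg => x /[apply] fgx.
  by rewrite !funeposE le_max2.
- apply: ae_ge0_le_integral => //; [exact: measurable_funeneg..|].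
  apply: filterS fg => x /[apply] fgx.
  by rewrite !funenegE le_max2// leeN2.
Qed.

Lemma expectation_gt0 (P : probability T R) (X : T -> R) :
  measurable_fun [set: T] X -> {ae P, forall x, (0 < X x)%R} -> 0 < 'E_P[X].
Proof.
move=> mX X0; rewrite unlock.
have mX' : measurable_fun [set: T] (EFin \o X) by exact/measurable_EFinP.
have -> : \int[P]_x (X x)%:E = \int[P]_x `|(EFin \o X) x|.
  apply: ae_eq_integral => //; first exact: measurableT_comp.
  by apply: filterS X0 => x X0 _ /=; rewrite gtr0_norm.
rewrite lt0e integral_ge0// andbT; apply/eqP.
move=> /ae_eq_integral_abs => /(_ measurableT mX') Xe0.
(* [X] would be both positive and zero almost everywhere, so a null set covers the whole space,
   against [P [set: T] = 1]. *)
have : {ae P, forall x : T, False}.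
  apply: filterS2 X0 Xe0 => x /= X0 /(_ I) [Xx0].
  by rewrite Xx0 ltxx in X0.
move=> [N [mN PN0 /(_ _ _)/= sN]].
have : P [set: T] <= P N.
  by apply: le_measure; rewrite ?inE//; move=> x _; exact: sN.
by rewrite probability_setT PN0 leNgt lte01.
Qed.

End integral_lemmas.

(** This is [ln (1 + x) <= x] at [x = t / c - 1]: the concave [ln] lies below its tangent at [c]. *)
Lemma ln_le_tangent (R : realType) (t c : R) : (0 < t)%R -> (0 < c)%R ->
  (ln t <= c^-1 * t + (ln c - 1))%R.
Proof.
move=> t0 c0; have tc : (0 < t / c)%R by exact: divr_gt0.
have := @le_ln1Dx R (t / c - 1) ltac:(lra).
by rewrite addrC subrK ln_div// [(c^-1 * t)%R]mulrC; lra.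
Qed.

(** For a finite mean [c], integrate the tangent bound at [c]; the integral of [ln X] may still be
    [-oo]. *)
Lemma jensen_ln d (T : measurableType d) (R : realType) (P : probability T R)
    (X : T -> R) :
  measurable_fun [set: T] X -> {ae P, forall x, (0 < X x)%R} ->
  expeR 'E_P[fun x => ln (X x)] <= 'E_P[X].
Proof.
move=> mX X0; have EX0 := expectation_gt0 mX X0.
have [EXoo|EXfin] := eqVneq 'E_P[X] +oo; first by rewrite EXoo leey.
have {}EXfin : 'E_P[X] \is a fin_num by rewrite ge0_fin_numE ?ltey// ltW.
pose c := fine 'E_P[X]; have EXc : 'E_P[X] = c%:E by rewrite fineK.
have c0 : (0 < c)%R by rewrite -lte_fin -EXc.
have mXE : measurable_fun [set: T] (EFin \o X) by exact/measurable_EFinP.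
have iX : P.-integrable [set: T] (EFin \o X).
  apply/integrableP; split => //.
  rewrite -(@ae_eq_integral _ _ _ P setT _ (EFin \o X))//.
  - by move: EXfin; rewrite unlock fin_numE -ltey => /andP[].
  - exact: measurableT_comp.
  - by apply: filterS X0 => x X0 _ /=; rewrite gtr0_norm.
have icst k : P.-integrable [set: T] (cst k%:E).
  exact: finite_measure_integrable_cst.
rewrite EXc -(lnK (_ : c \in Num.pos)) ?posrE//.
rewrite -[leRHS]/(expeR (ln c)%:E) lee_expeR.
(* The tangent is affine in [X], so its mean is its value at [c], namely
   [c^-1 * c + (ln c - 1) = ln c]. *)
have -> : (ln c)%:E = \int[P]_x ((c^-1)%:E * (X x)%:E + (ln c - 1)%:E).
  rewrite integralD; [|exact: measurableT|exact: integrableZl|exact: icst].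
  rewrite integralZl// integral_cst// [X in _ + _ * X]probability_setT mule1.
  move: (EXc); rewrite unlock => ->.
  by rewrite -EFinM mulVf ?gt_eqF// -EFinD addrC subrK.
rewrite unlock; apply: ae_le_integral => //.
- apply/measurable_EFinP; apply: measurableT_comp => //; exact: measurable_ln.
- by apply: emeasurable_funD => //; apply: measurable_funeM.
- by apply: filterS X0 => x X0 _ /=; rewrite -EFinM -EFinD lee_fin ln_le_tangent.
Qed.

(** * Radon-Nikodym derivatives: sign, change of variables, second moment *)

Section RN_deriv_lemmas.
Context d (T : measurableType d) (R : realType).
Variables P Q : probability T R.
Hypothesis PQ : P `<< Q.

Lemma EFin_RN_deriv x :
  (RN_deriv P Q x)%:E = ('d (charge_of_finite_measure P) '/d Q) x.
Proof. by rewrite fineK// Radon_Nikodym_fin_num. Qed.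

Lemma measurable_RN_deriv : measurable_fun [set: T] (RN_deriv P Q).
Proof.
apply/measurable_EFinP.
rewrite (_ : _ \o _ = 'd (charge_of_finite_measure P) '/d Q).
  exact/measurable_int/Radon_Nikodym_integrable.
by apply/funext => x /=; rewrite EFin_RN_deriv.
Qed.

Lemma integrable_RN_deriv :
  Q.-integrable [set: T] (fun x => (RN_deriv P Q x)%:E).
Proof.
rewrite (_ : (fun _ => _) = 'd (charge_of_finite_measure P) '/d Q).
  exact: Radon_Nikodym_integrable.
by apply/funext => x /=; rewrite EFin_RN_deriv.
Qed.

Lemma integral_RN_deriv A : measurable A ->
  \int[Q]_(x in A) (RN_deriv P Q x)%:E = P A.
Proof.
move=> mA; under eq_integral do rewrite EFin_RN_deriv.
by rewrite -Radon_Nikodym_integral.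
Qed.

(** On the set [N] where the derivative is nonpositive, [P N] is its [Q]-integral over [N], hence at
    most 0. *)
Lemma RN_deriv_gt0 : {ae P, forall x, (0 < RN_deriv P Q x)%R}.
Proof.
pose N := [set x | (RN_deriv P Q x <= 0)%R].
have mN : measurable N.
  rewrite -[N]setTI; exact: measurable_fun_le measurable_RN_deriv _.
exists N; split => //; last by move=> x /= /negP; rewrite -leNgt.
apply/eqP; rewrite eq_le measure_ge0 andbT -integral_RN_deriv//.
rewrite -[leRHS](integral0 Q N) le_integral//.
- exact: integrableS integrable_RN_deriv.
- exact: integrable0.
- by move=> x; rewrite inE lee_fin.
Qed.

(** Change of variables for nonnegative functions, where both sides may be [+oo], is applied to the
    sigma-finite form of the derivative, which agrees [Q]-a.e. with [RN_deriv]. *)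
Lemma expectation_mul_RN_deriv (X : T -> R) :
  measurable_fun [set: T] X -> (forall x, 0 <= X x)%R ->
  'E_Q[fun x => (X x * RN_deriv P Q x)%R] = 'E_P[X].
Proof.
move=> mX X0; rewrite unlock.
have mX' : measurable_fun [set: T] (EFin \o X) by exact/measurable_EFinP.
rewrite -(Radon_Nikodym_SigmaFinite.change_of_variables PQ _ _ mX')//.
apply: ae_eq_integral => //.
- by apply/measurable_EFinP/measurable_funM => //; exact: measurable_RN_deriv.
- apply: emeasurable_funM => //.
  exact/measurable_int/Radon_Nikodym_SigmaFinite.f_integrable.
apply: filterS (ae_eq_Radon_Nikodym_SigmaFinite PQ measurableT) => x /= xE xT.
by rewrite EFinM EFin_RN_deriv xE.
Qed.

(* In fact an equality, both sides being [\int[Q] g ^+ 2]; allowing an inequality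
   avoids having to show that the derivative [g] is nonnegative [Q]-a.e. *)
Lemma expectation_RN_deriv_le :
  'E_P[RN_deriv P Q] <= 'E_Q[fun x => ((RN_deriv P Q x - 1) ^+ 2)%R] + 1.
Proof.
set g := RN_deriv P Q; have mg : measurable_fun setT g := measurable_RN_deriv.
have mng : measurable_fun setT (fun x => `|g x|%R) by exact: measurableT_comp.
have mg12 : measurable_fun setT (fun x => (g x - 1) ^+ 2)%R.
  by apply: measurable_funX; exact: measurable_funB.
have [->|/eqP Xoo] := eqVneq 'E_Q[fun x => ((g x - 1) ^+ 2)%R] +oo.
  by rewrite addye// leey.
have ig12 : Q.-integrable setT (fun x => ((g x - 1) ^+ 2)%:E).
  apply/integrableP; split; first exact/measurable_EFinP.
  rewrite (eq_integral (fun x => ((g x - 1) ^+ 2)%:E)).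
    by move/eqP: Xoo; rewrite -ltey unlock.
  by move=> x _; rewrite gee0_abs// lee_fin sqr_ge0.
have ig : Q.-integrable setT (fun x => (g x)%:E) by exact: integrable_RN_deriv.
have i2g : Q.-integrable setT (fun x => 2%:E * (g x)%:E) by exact: integrableZl.
have i1 : Q.-integrable setT (cst (-1)%:E).
  exact: finite_measure_integrable_cst.
have i2g1 : Q.-integrable setT (fun x => 2%:E * (g x)%:E + (-1)%:E).
  exact: integrableD.
(* [g > 0] is known only [P]-a.e., while [expectation_mul_RN_deriv] asks for a function nonnegative
   everywhere. *)
have -> : 'E_P[g] = 'E_P[fun x => `|g x|%R].
  rewrite unlock; apply: ae_eq_integral => //; [exact/measurable_EFinP..|].
  by apply: filterS RN_deriv_gt0 => x g0 _ /=; rewrite gtr0_norm.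
rewrite -expectation_mul_RN_deriv// unlock.
(* As [g] has [Q]-mean 1, so has [2 * g - 1]. Adding it to [(g - 1) ^+ 2] gives [g ^+ 2], which
   bounds [|g| * g] pointwise. *)
have -> : 1 = \int[Q]_x (2%:E * (g x)%:E + (-1)%:E).
  rewrite integralD; [|exact: measurableT|exact: i2g|exact: i1].
  rewrite integralZl// integral_RN_deriv// integral_cst//.
  rewrite !probability_setT mule1 [X in _ * X]probability_setT mule1.
  by rewrite -EFinD; congr EFin; lra.
rewrite -integralD; [|exact: measurableT|exact: ig12|exact: i2g1].
apply: ae_le_integral => //.
- by apply/measurable_EFinP; exact: measurable_funM.
- apply: emeasurable_funD; first exact/measurable_EFinP.
  exact: (measurable_int _ i2g1).
apply: aeW => x _; rewrite -EFinM -!EFinD lee_fin -/g.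
have -> : ((g x - 1) ^+ 2 + (2 * g x + -1) = `|g x| * `|g x|)%R.
  by rewrite -expr2 real_normK ?num_real//; ring.
by rewrite ler_wpM2l// ler_norm.
Qed.

End RN_deriv_lemmas.

(** * The optimal proposal, its density, and the relative error *)

Section optimal_proposal.
Context d (T : measurableType d) (R : realType).
Variables (nu : probability T R) (W : T -> R).
Hypothesis mW : measurable_fun [set: T] W.
Hypothesis Zfin : partition_fun nu W < +oo.

Let measurable_weight : measurable_fun [set: T] (fun x => expR (- W x)).
Proof. by apply: measurableT_comp => //; exact: measurableT_comp. Qed.

Lemma partition_fun_gt0 : 0 < partition_fun nu W.
Proof. by apply: expectation_gt0 => //; apply: aeW => x; exact: expR_gt0. Qed.

Lemma partition_fun_fin_num : partition_fun nu W \is a fin_num.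
Proof. by rewrite ge0_fin_numE// ltW// partition_fun_gt0. Qed.

Lemma integrable_weight : nu.-integrable [set: T] (fun x => (expR (- W x))%:E).
Proof.
apply/integrableP; split; first exact/measurable_EFinP.
rewrite (eq_integral (fun x => (expR (- W x))%:E)).
  by move: Zfin; rewrite /partition_fun unlock.
by move=> x _; rewrite gee0_abs// lee_fin expR_ge0.
Qed.

Variables nus nut : probability T R.
Hypothesis hs : is_optimal_proposal nu W nus.

Lemma optimal_proposalE A : measurable A ->
  partition_fun nu W * nus A = \int[nu]_(x in A) (expR (- W x))%:E.
Proof.
move=> mA; rewrite hs// -(fineK partition_fun_fin_num) inver.
(* [inver] treats the inverse of 0 separately; a nonzero [Z] selects the real inverse. *)
have Z0 : fine (partition_fun nu W) != 0%R.
  by rewrite fine_eq0 ?partition_fun_fin_num// gt_eqF// partition_fun_gt0.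
rewrite (negbTE Z0) integralZr//; last first.
  by apply: integrableS integrable_weight.
by rewrite muleCA -EFinM divff// mule1.
Qed.

Lemma optimal_proposal_dominated : nus `<< nu.
Proof.
apply/null_content_dominatesP => A mA A0.
have /eqP := optimal_proposalE mA; rewrite null_set_integral//.
  by rewrite mule_eq0 gt_eqF ?partition_fun_gt0//= => /eqP.
by apply/measurable_EFinP; exact: measurable_funTS.
Qed.

Hypothesis hdom : nu `<< nut.

Let nus_nut : nus `<< nut.
Proof. exact: null_dominates_trans optimal_proposal_dominated hdom. Qed.

(** By uniqueness of densities: over each measurable [A] both sides have [nut]-integral [Z * nus A],
    the weighted one by change of variables to [nu] and [optimal_proposalE]. *)
Lemma weight_RN_derivE :
  {ae nut, forall x, (expR (- W x) * RN_deriv nu nut x =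
    fine (partition_fun nu W) * RN_deriv nus nut x)%R}.
Proof.
have fE : \forall x \ae nut, [set: T] x ->
    (fine (partition_fun nu W))%:E * (RN_deriv nus nut x)%:E =
    (expR (- W x))%:E * (RN_deriv nu nut x)%:E.
  apply: integral_ae_eq => //.
  - by apply: integrableZl => //; exact: integrable_RN_deriv.
  - apply: emeasurable_funM; apply/measurable_EFinP => //.
    exact: measurable_RN_deriv.
  move=> A _ mA; rewrite integralZl//; last first.
    by apply: (integrableS measurableT) => //; exact: integrable_RN_deriv.
  rewrite integral_RN_deriv// fineK ?partition_fun_fin_num//.
  rewrite optimal_proposalE//.
  rewrite -(Radon_Nikodym_change_of_variables hdom)//; last first.
    exact: integrableS integrable_weight.
  by apply: eq_integral => x _; rewrite -EFin_RN_deriv.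
by apply: filterS fE => x /(_ I); rewrite -!EFinM => -[].
Qed.

(** The weight has [nut]-mean [Z], so its deviation from the mean is a.e. [Z * (g - 1)], with [g]
    the derivative of [nus]. Squares are nonnegative, so [Z ^+ 2] passes through the integral even
    if that is infinite. *)
Lemma variance_weight_RN_deriv :
  'V_nut[fun x => (expR (- W x) * RN_deriv nu nut x)%R] =
  (partition_fun nu W) ^+ 2 *
  'E_nut[fun x => ((RN_deriv nus nut x - 1) ^+ 2)%R].
Proof.
have mg : measurable_fun setT (RN_deriv nus nut) by exact: measurable_RN_deriv.
rewrite /variance unlock expectation_mul_RN_deriv//.
rewrite -/(partition_fun nu W) -[X in X ^+ 2](fineK partition_fun_fin_num).
set Z := fine _; rewrite unlock -EFin_expe -ge0_integralZl//; first last.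
- by rewrite lee_fin sqr_ge0.
- by move=> x _; rewrite lee_fin sqr_ge0.
- apply/measurable_EFinP; apply: measurable_funX; exact: measurable_funB.
have mX : measurable_fun setT (fun x => expR (- W x) * RN_deriv nu nut x - Z)%R.
  apply: measurable_funB => //; apply: measurable_funM => //.
  exact: measurable_RN_deriv.
apply: ae_eq_integral => //.
- by apply/measurable_EFinP; exact: measurable_funM.
- apply: emeasurable_funM => //; apply/measurable_EFinP.
  by apply: measurable_funX; exact: measurable_funB.
apply: filterS weight_RN_derivE => x xE _.
rewrite -EFinM; congr EFin.
transitivity ((expR (- W x) * RN_deriv nu nut x - Z) ^+ 2)%R => //.
by rewrite xE -/Z; ring.
Qed.

(** Under the root stands the chi-square divergence of [nus] from [nut]; [Z ^+ 2] leaves the root as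
    [Z] and cancels, since [0 < Z < +oo]. *)
Lemma relative_errorE :
  relative_error nu W nut =
  sqrte 'E_nut[fun x => ((RN_deriv nus nut x - 1) ^+ 2)%R].
Proof.
rewrite /relative_error variance_weight_RN_deriv sqrteM ?sqre_ge0//.
rewrite sqrte_sqr gee0_abs ?ltW ?partition_fun_gt0// muleA.
by rewrite mulVe ?mul1e ?partition_fun_fin_num// gt_eqF ?partition_fun_gt0.
Qed.

End optimal_proposal.

Theorem proposition2p2 (d : measure_display) (T : measurableType d)
    (R : realType) (nu : probability T R) (W : T -> R)
    (mW : measurable_fun [set: T] W)
    (Zfin : partition_fun nu W < +oo)
    (nustar : probability T R) (hstar : is_optimal_proposal nu W nustar)
    (nutilde : probability T R) (hdom : nu `<< nutilde) :
  relative_error nu W nutilde >= sqrte (expeR (KL nustar nutilde) - 1).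
Proof.
have dom : nustar `<< nutilde.
  exact: null_dominates_trans (optimal_proposal_dominated mW Zfin hstar) hdom.
rewrite (relative_errorE mW Zfin hstar hdom) lee_sqrt; last first.
  by apply: expectation_ge0 => x; exact: sqr_ge0.
(* Domination selects the expectation branch of [KL]; with 1 moved across, the two bounds meet at
   the [nustar]-mean of the density. *)
rewrite /KL asboolT// leeBlDr//.
apply: le_trans (expectation_RN_deriv_le dom).
exact: jensen_ln (measurable_RN_deriv dom) (RN_deriv_gt0 dom).
Qed.
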